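(* For all $n\ge 1$ and $j\ge 0$, $a^{(1)}_{n,231,j}=h_3(n+1,n-j)$. Consequently $$\binom{n}{2j}=N(n,j+1)-\Big[\widetilde Q_1(n,j,3)-2\widetilde Q_0(n,j,3)+\widetilde Q_{-1}(n,j,3)\Big],$$ where $N(n,j+1)=\frac1n\binom{n}{j+1}\binom{n}{j}$ and $$\widetilde Q_a(n,j,3)=\sum_{s\ge 1}\binom{n-2s-1}{j-3s-a}\binom{n+2s-1}{j+3s+a}.$$
   Context: For $n\ge 1$ and $j,k\ge 0$, $a^{(k)}_{n,231,j}$ denotes the number of permutations $\sigma=\sigma_1\cdots\sigma_n$ of $[n]$ that avoid $231$ (no indices $a<b<c$ with $\sigma_c<\sigma_a<\sigma_b$), have exactly $j$ descents (indices $i\in[n-1]$ with $\sigma_i>\sigma_{i+1}$), and satisfy $\max\{i-\sigma_i: i\in[n]\}\le k$. For positive integers $m,\ell,r$, $h_r(m,\ell)$ is the number of ordered trees (rooted trees with linearly ordered children) with $m$ nodes, $\ell$ leaves, and height (maximum distance from a vertex to the root) at most $r-1$. Binomial coefficients $\binom{p}{q}$ with $q<0$ are $0$. *)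

(* Defs.v *)
From HB Require Import structures.
From mathcomp Require Import all_boot all_order all_fingroup all_algebra.
From mathcomp Require Import finmap.
From mathcomp Require Import mathcomp_extra boolp classical_sets functions.
From mathcomp Require Import cardinality fsbigop.

Set Implicit Arguments.
Unset Strict Implicit.
Unset Printing Implicit Defensive.

Import Order.TTheory GRing.Theory Num.Theory.

(* Permutations of [n] are indexed from 0: [s i] stands for sigma_(i+1) - 1.   *)
(* Pattern containment, descents and the differences i - sigma_i are           *)
(* insensitive to this shift.                                                  *)

Definition avoids231 (n : nat) (s : 'S_n) : bool :=
  [forall a : 'I_n, forall b : 'I_n, forall c : 'I_n,
     [&& a < b & b < c] ==> ~~ [&& s c < s a & s a < s b]].

Definition descents (n : nat) (s : 'S_n) : nat :=
  #|[set i : 'I_n | [exists i' : 'I_n, (i' == i.+1 :> nat) && (s i' < s i)]]|.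

(* The subtraction is truncated, which does not change the maximum for n > 0:  *)
(* the integers i - s i sum to 0, so their maximum is nonnegative.             *)
Definition maxdrop (n : nat) (s : 'S_n) : nat := \max_(i < n) (i - s i).

Definition a231 (k n j : nat) : nat :=
  #|[set s : 'S_n | [&& avoids231 s, descents s == j & maxdrop s <= k]]|.

Inductive otree : Type := ONode of seq otree.

Fixpoint otree_encode (t : otree) : GenTree.tree unit :=
  let: ONode s := t in GenTree.Node 0 [seq otree_encode u | u <- s].

Fixpoint otree_decode (g : GenTree.tree unit) : otree :=
  if g is GenTree.Node _ s then ONode [seq otree_decode u | u <- s]
  else ONode [::].

Lemma otree_encodeK : cancel otree_encode otree_decode.
Proof.
rewrite /cancel; fix IH 1; case=> s /=; congr ONode.
by elim: s => //= t s ->; rewrite IH.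
Qed.

HB.instance Definition _ := Countable.copy otree (can_type otree_encodeK).

Fixpoint nodes (t : otree) : nat :=
  let: ONode s := t in (sumn [seq nodes u | u <- s]).+1.

Fixpoint leaves (t : otree) : nat :=
  let: ONode s := t in
  if s is [::] then 1 else sumn [seq leaves u | u <- s].

Fixpoint height (t : otree) : nat :=
  let: ONode s := t in foldr maxn 0 [seq (height u).+1 | u <- s].

Definition htrees (r m l : nat) : set otree :=
  [set t | [/\ nodes t = m, leaves t = l & height t <= r.-1]]%classic.

(* [fset_set] is empty on infinite sets; that case does not occur here.        *)
Lemma finite_htrees (r m l : nat) : finite_set (htrees r m l).
Proof.
suff [L LP] : exists L : seq otree, forall t, nodes t <= m -> t \in L.
  apply: (@sub_finite_set _ _ [set` L]); last exact: finite_seq.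
  by move=> t [tm _ _] /=; apply: LP; rewrite tm.
elim: m => [|m [L LP]]; first by exists [::] => -[].
pose T k := [seq ONode (map val (tval u)) | u <- enum {: k.-tuple (seq_sub L)}].
exists (flatten [seq T k | k <- iota 0 m.+1]).
case=> s; rewrite [nodes _]/= ltnS => sm.
have sz : size s <= m.
  apply: leq_trans sm; elim: s => //= -[u] s IHs /=.
  by rewrite addSn ltnS (leq_trans IHs) ?leq_addl.
have sL : all [in L] s.
  apply/allP => t ts; apply: LP; apply: leq_trans sm.
  elim: s ts {sz} => //= u s IHs; rewrite inE => /predU1P[->|/IHs ts].
    exact: leq_addr.
  exact: leq_trans ts (leq_addl _ _).
have [w ws] : exists w : seq (seq_sub L), map val w = s.
  elim: s sL {sm sz} => [|u s IHs] /=; first by exists [::].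
  by case/andP=> uL /IHs[w <-]; exists (SeqSub uL :: w).
have szw : size w == size s by rewrite -ws size_map.
apply/flatten_mapP; exists (size s); first by rewrite mem_iota.
by apply/mapP; exists (Tuple szw); rewrite ?mem_enum //= ws.
Qed.

(* For l = 0 this is 0, since every tree has a leaf (a lone root is one); so   *)
(* with l := n - j truncated the count vanishes for j >= n, as it should.      *)
Definition htree (r m l : nat) : nat := #|` fset_set (htrees r m l)|.

Local Open Scope ring_scope.

(* 'C(p, q) for integers p and q, equal to p(p-1)...(p-q+1)/q! for q >= 0;     *)
(* recall that Negz p = -(p+1).                                                *)
Definition binz (p q : int) : int :=
  match p, q with
  | _, Negz _ => 0
  | Posz p, Posz q => 'C(p, q)%:Z
  | Negz p, Posz q => (-1) ^+ q * 'C(p + q, q)%:Z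
  end.

Definition narayana (n k : nat) : rat :=
  n%:R^-1 * (binz n k)%:~R * (binz n (k%:Z - 1))%:~R.

(* All but finitely many terms vanish, since j - 3s - a < 0 for large s, so    *)
(* the finitely supported sum below is the full series.                        *)
Definition Qtilde3 (a : int) (n j : nat) : int :=
  \sum_(s \in [set s : nat | (1 <= s)%N]%classic)
     binz (n%:Z - 2 * s%:Z - 1) (j%:Z - 3 * s%:Z - a)
     * binz (n%:Z + 2 * s%:Z - 1) (j%:Z + 3 * s%:Z + a).

(* Main.v *)
Require Import Defs.
From mathcomp Require Import all_boot all_order all_fingroup all_algebra.
From mathcomp Require Import zify ring.
From mathcomp Require Import finmap classical_sets cardinality fsbigop.

Import Order.TTheory GRing.Theory Num.Theory.

(* A 231-avoiding permutation with all drops at most 1 has its last value among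
   the two largest ones, and deleting the last entry gives any permutation of
   the same kind. An ordered tree of height at most 2 arises from a smaller one
   by adding a first leaf to the root or to the first child of the root. Both
   growth processes are binary and act in the same way on the pair made of a
   flag (is the last entry the maximum? is the first child a leaf?) and the
   number of descents, resp. of inner nodes other than the root.

   For the binomial identity let T_a(s) be the s-th term of Qtilde_a, for all
   integers s. Since T_a(-s) = T_{-a}(s) and T_0(0) - T_1(0) = N(n, j+1), the
   right-hand side is the sum of T_0(s) - T_1(s) over all integers s. Applying
   to this sum the recurrence f(n+2, j+1) - 2 f(n+1, j+1) + f(n, j+1) = f(n, j)
   of f(n, j) = C(n, 2j), the defect telescopes to 0. *)

(** * Permutations grown at their last entry *)

Lemma lift_perm_inj (n : nat) (i0 : 'I_n.+1) :
  injective (fun kt : 'I_n.+1 * 'S_n => lift_perm i0 kt.1 kt.2).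
Proof.
move=> [k t] [k' t'] /= E.
have Ek : k = k' by have := congr1 (fun s : 'S_n.+1 => s i0) E; rewrite !lift_perm_id.
rewrite {}Ek in E *; congr pair; apply/permP=> x.
apply: (@lift_inj _ k').
by have := congr1 (fun s : 'S_n.+1 => s (lift i0 x)) E; rewrite !lift_perm_lift.
Qed.

Lemma lift_perm_surj (n : nat) (i0 : 'I_n.+1) (s : 'S_n.+1) :
  exists t : 'S_n, s = lift_perm i0 (s i0) t.
Proof.
(* Surjectivity follows from injectivity by counting, as (n + 1) n! = (n + 1)!. *)
have [|g _ gK] := @inj_card_bij _ _ _ (@lift_perm_inj n i0).
  by rewrite card_prod !card_Sn card_ord factS.
exists (g s).2; rewrite -{1}(gK s); congr (lift_perm _ _ _).
by rewrite -{2}(gK s) lift_perm_id.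
Qed.

Definition good {n : nat} (s : 'S_n) : bool := avoids231 s && (maxdrop s <= 1).

Lemma goodP (n : nat) (s : 'S_n) :
  reflect ((forall a b c : 'I_n, a < b -> b < c -> s c < s a -> s a < s b -> False)
           /\ forall i : 'I_n, i <= (s i).+1) (good s).
Proof.
apply: (iffP andP) => -[av dr]; split.
- move=> a b c ab bc ca ba; move/forallP/(_ a)/forallP/(_ b)/forallP/(_ c): av.
  by rewrite ab bc ca ba.
- by move=> i; move/bigmax_leqP: dr => /(_ i isT); lia.
- apply/forallP=> a; apply/forallP=> b; apply/forallP=> c; apply/implyP => /andP[ab bc].
  by apply/negP => /andP[]; exact: av ab bc.
- by apply/bigmax_leqP=> i _; have := dr i; lia.
Qed.

Lemma val_lift_perm (n : nat) (k : 'I_n.+1) (t : 'S_n) (i : 'I_n) :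
  lift_perm ord_max k t (lift ord_max i) = (k <= t i) + t i :> nat.
Proof. by rewrite lift_perm_lift. Qed.

(** The drop at the last position forces [n <= k]. Conversely, at most one value then exceeds [k],
    while a 231 pattern ending at the last entry needs two. Inserting [k] raises at most the value
    [n] of [t], whose drop is never positive. *)
Lemma good_lift_perm (n : nat) (k : 'I_n.+2) (t : 'S_n.+1) :
  good (lift_perm ord_max k t) = (n <= k) && good t.
Proof.
set s := lift_perm _ _ _.
have sl i : s (lift ord_max i) = (k <= t i) + t i :> nat := val_lift_perm _ k t i.
have sm : s ord_max = k by rewrite /s lift_perm_id.
apply/goodP/andP => [[av dr]|[nk /goodP[av dr]]].
  split; first by have := dr ord_max; rewrite sm ltnS.
  apply/goodP; split=> [a b c ab bc ca ba|i].
    apply: (av (lift ord_max a) (lift ord_max b) (lift ord_max c)); rewrite ?lift_max ?sl; lia.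
  have := dr (lift ord_max i); rewrite lift_max sl.
  by have := ltn_ord (t i); have := ltn_ord i; have := dr ord_max; rewrite sm /=; lia.
have kn := ltn_ord k.
split=> [a b c|i].
  case: (unliftP ord_max a) => [a'|] ->; case: (unliftP ord_max b) => [b'|] ->;
  case: (unliftP ord_max c) => [c'|] ->; rewrite ?lift_max ?sl ?sm /=.
  - by move=> ab bc; have := av a' b' c' ab bc; lia.
  - by have /= := ltn_ord (t a'); have /= := ltn_ord (t b'); lia.
  - by have /= := ltn_ord c'; lia.
  - lia.
  - by have /= := ltn_ord b'; lia.
  - by have /= := ltn_ord b'; lia.
  - by have /= := ltn_ord c'; lia.
  - lia.
case: (unliftP ord_max i) => [i'|] ->; rewrite ?lift_max ?sl ?sm /=; last lia.
by have := dr i'; lia.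
Qed.

Lemma descentsE (n : nat) (s : 'S_n.+1) :
  descents s = \sum_(i < n) (s (inord i.+1) < s (inord i)).
Proof.
rewrite /descents -sum1_card big_mkcond big_ord_recr /= [X in _ + X]ifF ?addn0.
  apply: eq_bigr => i _; rewrite inE.
  have -> : widen_ord (leqnSn n) i = inord i.
    by apply: val_inj; rewrite /= inordK //; have := ltn_ord i; lia.
  have e : (inord i.+1 : 'I_n.+1) = i.+1 :> nat by rewrite inordK // ltnS.
  case: existsP => [[i' /andP[/eqP ei' lt]]|no].
    have -> : inord i.+1 = i'.
      by apply: val_inj; rewrite /= e ei' inordK //; have := ltn_ord i; lia.
    by rewrite lt.
  case: (boolP (_ < _)) => // lt; case: no; exists (inord i.+1).
  by rewrite lt e inordK ?eqxx //; have := ltn_ord i; lia.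
rewrite inE; apply/existsP => -[i /andP[/eqP e _]]; have := ltn_ord i; rewrite e /=; lia.
Qed.

Lemma descents_lift_perm (n : nat) (k : 'I_n.+2) (t : 'S_n.+1) :
  descents (lift_perm ord_max k t) = (descents t + (k <= t ord_max))%N.
Proof.
rewrite !descentsE big_ord_recr /=; congr (_ + _).
  apply: eq_bigr => i _.
  have il m : m <= n -> inord m = lift ord_max (inord m : 'I_n.+1) :> 'I_n.+2.
    by move=> mn; apply: val_inj; rewrite /= /bump !inordK; lia.
  have := ltn_ord i => ?.
  by rewrite (il i.+1) // (il i (ltnW (ltn_ord i))) !val_lift_perm; congr nat_of_bool; lia.
have -> : inord n.+1 = ord_max :> 'I_n.+2 by apply: val_inj; rewrite /= inordK.
have -> : inord n = lift ord_max ord_max :> 'I_n.+2.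
  by apply: val_inj; rewrite /= /bump inordK; lia.
by rewrite lift_perm_id val_lift_perm; congr nat_of_bool; lia.
Qed.

(* Pairs (b, j), one for each element of size n grown from a single element of
   size 0 by two operations: b tells whether the last operation was the first
   one, and j counts the switches from the first one to the second one. *)
Fixpoint stats (n : nat) : seq (bool * nat) :=
  if n is m.+1 then
    [seq (true, x.2) | x <- stats m] ++ [seq (false, x.1 + x.2) | x : bool * nat <- stats m]
  else [:: (true, 0)].

Fixpoint good_perms (n : nat) : seq 'S_n.+1 :=
  if n is m.+1 then
    [seq lift_perm ord_max ord_max t | t <- good_perms m]
    ++ [seq lift_perm ord_max (inord m) t | t <- good_perms m]
  else [:: 1%g].

Lemma inord_neq_max n : (inord n == ord_max :> 'I_n.+2) = false.
Proof. by apply/eqP => /(congr1 val) /=; rewrite inordK //; lia. Qed.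

Lemma mem_good_perms n (s : 'S_n.+1) : (s \in good_perms n) = good s.
Proof.
elim: n s => [|n IHn] s.
  rewrite inE; have -> : s = 1%g by apply/permP => i; rewrite !ord1.
  rewrite eqxx; symmetry; apply/goodP; split=> [a b c|i]; rewrite !ord1 //.
have [t ->] := @lift_perm_surj _ ord_max s.
set k := s ord_max; rewrite good_lift_perm -IHn mem_cat.
have mem (k' : 'I_n.+2) :
  (lift_perm ord_max k t \in [seq lift_perm ord_max k' t | t <- good_perms n])
   = (k == k') && (t \in good_perms n).
  apply/mapP/andP => [[t' t'in E]|[/eqP -> tin]]; last by exists t.
  by have [-> ->] := @lift_perm_inj _ _ (k, t) (k', t') E.
rewrite !mem -andb_orl; congr (_ && _).
have kn := ltn_ord k.
by rewrite -!val_eqE /= inordK //; lia.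
Qed.

Lemma uniq_good_perms n : uniq (good_perms n).
Proof.
elim: n => //= n IHn; rewrite cat_uniq !map_inj_uniq ?IHn ?andbT //=.
- apply/hasPn => s /mapP[t _ ->]; apply/mapP => -[t' _].
  move/(@lift_perm_inj _ _ (_, _) (_, _)) => [/eqP].
  by rewrite inord_neq_max.
- by move=> t t' /(@lift_perm_inj _ _ (_, _) (_, _)) [].
- by move=> t t' /(@lift_perm_inj _ _ (_, _) (_, _)) [].
Qed.

Lemma stats_good_perms n :
  [seq (s ord_max == ord_max, descents s) | s : 'S_n.+1 <- good_perms n] = stats n.
Proof.
elim: n => [|n IHn] /=; first by rewrite perm1 eqxx descentsE big_ord0.
rewrite map_cat -!map_comp -IHn -!map_comp; congr (_ ++ _); apply: eq_map => t /=;
  rewrite lift_perm_id descents_lift_perm ?eqxx ?inord_neq_max; congr pair.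
  by rewrite leqNgt ltn_ord addn0.
(* Appending the second largest value creates a descent exactly when [t] ends in its maximum. *)
rewrite addnC inordK // -val_eqE /=; congr (nat_of_bool _ + _).
by have := ltn_ord (t ord_max); lia.
Qed.

Lemma a231_1E n j : a231 1 n.+1 j = count (fun x => x.2 == j) (stats n).
Proof.
rewrite -stats_good_perms count_map -size_filter.
rewrite -(card_uniqP _) ?filter_uniq ?uniq_good_perms //; apply: eq_card => s.
by rewrite inE mem_filter mem_good_perms /= andbCA.
Qed.

(** * Ordered trees of height at most 2 *)

Definition leaf : otree := ONode [::].

Definition add_leaf (t : otree) : otree := let: ONode s := t in ONode (leaf :: s).

(** The value at a lone root is a default: every tree in [height2_trees] has at least two nodes. *)
Definition add_subleaf (t : otree) : otree :=
  if t is ONode (u :: s) then ONode (add_leaf u :: s) else t.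

Fixpoint height2_trees (n : nat) : seq otree :=
  if n is m.+1 then
    [seq add_leaf t | t <- height2_trees m] ++ [seq add_subleaf t | t <- height2_trees m]
  else [:: ONode [:: leaf]].

Lemma nodes_gt0 t : 0 < nodes t. Proof. by case: t. Qed.

(** To undo the growth, delete the first child of the root if it is a leaf, and the first child of
    that child otherwise. *)
Lemma mem_height2_trees n t :
  (t \in height2_trees n) = (nodes t == n.+2) && (height t <= 2).
Proof.
apply/idP/andP => [|[/eqP]].
  elim: n t => [|n IHn] t /=; first by rewrite inE => /eqP->.
  rewrite mem_cat => /orP[] /mapP[t' /IHn[/eqP + +] ->].
    by case: t' => s /= [->]; rewrite geq_max => ->; rewrite eqxx.
  by case: t' => -[|[u] s] //= [e] h; rewrite -e !addSn; split; move: h; lia.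
elim: n t => [|n IHn] [[|[[|v u]] s]] //=.
- by case: s => //= u s; have := nodes_gt0 u; lia.
- by have := nodes_gt0 v; lia.
- rewrite add1n geq_max => -[e] /andP[_ h]; rewrite mem_cat; apply/orP; left.
  by apply/mapP; exists (ONode s) => //; apply: IHn; rewrite //= e.
rewrite !(geq_max, ltnS) => -[e] /andP[/andP[hv hu] hs]; rewrite mem_cat; apply/orP; right.
(* [v] has depth 2, so the height bound leaves it no children. *)
have v0 : v = leaf by case: v hv {e} => -[] //= w r; rewrite geq_max.
rewrite v0 /= in e *.
apply/mapP; exists (ONode (ONode u :: s)) => //; apply: IHn => /=.
  by move: e; lia.
  by move: hu hs; lia.
Qed.

Definition first_leaf (t : otree) : bool :=
  if t is ONode (ONode [::] :: _) then true else false.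

Lemma add_leaf_inj : injective add_leaf.
Proof. by case=> s [s'] [->]. Qed.

Lemma uniq_height2_trees n : uniq (height2_trees n).
Proof.
elim: n => //= n IHn; rewrite cat_uniq map_inj_uniq ?IHn /=; last exact: add_leaf_inj.
apply/andP; split.
  apply/hasPn => t /mapP[[[|[u] s]]].
    by rewrite mem_height2_trees.
  by move=> _ ->; apply/mapP => -[[s'] _].
rewrite map_inj_in_uniq // => -[[|[u] s]] [[|[u'] s']];
  rewrite ?mem_height2_trees //= => _ _ [-> ->] //.
Qed.

Lemma leaves_height2_trees n t :
  t \in height2_trees n -> 0 < leaves t <= n.+1.
Proof.
elim: n t => [|n IHn] t /=; first by rewrite inE => /eqP->.
rewrite mem_cat => /orP[] /mapP[t' /[dup] t'in /IHn + ->].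
  by case: t' t'in => -[|u s]; rewrite ?mem_height2_trees //= => _; lia.
case: t' t'in => -[|[u] s]; rewrite ?mem_height2_trees //=; case: u => [|u r] /=; lia.
Qed.

(** Among n + 2 nodes, [n.+1 - leaves t] counts the inner nodes other than the root. Only
    [add_subleaf] can create one, namely when the first child was a leaf. *)
Lemma stats_height2_trees n :
  [seq (first_leaf t, n.+1 - leaves t) | t <- height2_trees n] = stats n.
Proof.
elim: n => [|n IHn] //=.
rewrite map_cat -!map_comp -IHn -!map_comp; congr (_ ++ _);
  apply/eq_in_map => t /[dup] tin /leaves_height2_trees;
  case: t tin => -[|[u] s]; rewrite ?mem_height2_trees //= => _.
  by case: u => [|u r] /= ?; congr pair; lia.
Qed.

Lemma htree3E n j : htree 3 n.+2 (n.+1 - j) = count (fun x => x.2 == j) (stats n).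
Proof.
rewrite -stats_height2_trees count_map -size_filter /htree.
have -> : fset_set (htrees 3 n.+2 (n.+1 - j))
  = [fset t in [seq t <- height2_trees n | n.+1 - leaves t == j]]%fset.
  apply/fsetP => t; rewrite in_fset_set ?inE /=; last exact: finite_htrees.
  rewrite mem_filter; apply/idP/idP; rewrite inE /=.
    move=> [tn tl th]; have tin: t \in height2_trees n by rewrite mem_height2_trees tn th eqxx.
    (* The bounds on [leaves t] make the subtraction exact; for j > n they exclude the truncated
       value 0. *)
    by rewrite tin andbT; have := leaves_height2_trees _ _ tin; lia.
  move=> /andP[/eqP e tin]; have := leaves_height2_trees _ _ tin.
  by move: tin; rewrite mem_height2_trees => /andP[/eqP tn th] ?; split => //; lia.
by rewrite card_fseq undup_id // filter_uniq ?uniq_height2_trees.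
Qed.

Local Open Scope ring_scope.

(** * Binomials with integer arguments *)

Lemma binz_neg (p q : int) : q < 0 -> binz p q = 0.
Proof. by case: q p => // q [p|p]. Qed.

Lemma binz0 (p : int) : binz p 0 = 1.
Proof. by case: p => p; rewrite /= ?bin0 ?mulr1. Qed.

Lemma binz_small (p q : int) : 0 <= p -> p < q -> binz p q = 0.
Proof. by case: p q => p [q|q] //= _ pq; rewrite bin_small. Qed.

Lemma binz_pascal (p q : int) : binz (p + 1) q = binz p q + binz p (q - 1).
Proof.
case: q => [[|q]|q]; last by rewrite !binz_neg ?addr0 //; lia.
  by rewrite !binz0 (binz_neg _ (_ - 1)) ?addr0 //; lia.
have -> : q.+1%:Z - 1 = q by lia.
case: p => [p|[|p]].
- by rewrite -PoszD addn1 /= binS PoszD.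
(* At p = -1 the left side enters the nonnegative branch and is 0; the two terms on the right are
   opposite signs. *)
- by rewrite /= !add0n !binn !mulr1 exprS mulN1r addNr.
have -> : Negz p.+1 + 1 = Negz p by lia.
rewrite /= exprS !mulN1r !mulNr addSn addnS (binS (p + q).+1) PoszD.
by ring.
Qed.

(** * The sum over all integers s and its recurrence *)

Definition cyl_term (a s : int) (n j : nat) : int :=
  binz (n%:Z - 2 * s - 1) (j%:Z - 3 * s - a)
  * binz (n%:Z + 2 * s - 1) (j%:Z + 3 * s + a).

Lemma cyl_termN a s n j : cyl_term a (- s) n j = cyl_term (- a) s n j.
Proof. by rewrite /cyl_term mulrC; congr (binz _ _ * binz _ _); ring. Qed.

Definition cyl_diff (s : int) (n j : nat) : int := cyl_term 0 s n j - cyl_term 1 s n j.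

(** Its differences in [s] are the defect of the recurrence: in the operator notation below it is
    y^3 (1 + x)^2 at [s] and x^3 (1 + y)^2 at [s + 1]. *)
Definition cyl_flux (s : int) (n j : nat) : int :=
  binz (n%:Z + 1 - 2 * s) (j%:Z + 1 - 3 * s) * binz (n%:Z - 1 + 2 * s) (j%:Z - 1 + 3 * s).

(* Write x and y for the operators lowering the lower index of the first, resp.
   second, binomial. By Pascal's rule (1 + x)(1 + y) shifts n, and xy shifts j.
   The identity is x^3 (1 + y)^2 - y^3 (1 + x)^2
   = (x - y) (((1 + x) (1 + y) - 1)^2 - xy). *)
Lemma cyl_diff_rec s n j :
  cyl_diff s n.+2 j.+1 - 2 * cyl_diff s n.+1 j.+1 + cyl_diff s n j.+1 - cyl_diff s n j
  = cyl_flux s n j - cyl_flux (s + 1) n j.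
Proof.
rewrite /cyl_diff /cyl_term /cyl_flux.
set N := n%:Z - 2 * s - 1; set M := n%:Z + 2 * s - 1.
set K := j%:Z + 1 - 3 * s; set L := j%:Z + 2 + 3 * s.
have -> : n.+2%:Z - 2 * s - 1 = N + 1 + 1 by rewrite /N; lia.
have -> : n.+1%:Z - 2 * s - 1 = N + 1 by rewrite /N; lia.
have -> : n.+2%:Z + 2 * s - 1 = M + 1 + 1 by rewrite /M; lia.
have -> : n.+1%:Z + 2 * s - 1 = M + 1 by rewrite /M; lia.
have -> : n%:Z + 1 - 2 * s = N + 1 + 1 by rewrite /N; lia.
have -> : n%:Z + 1 - 2 * (s + 1) = N by rewrite /N; lia.
have -> : n%:Z - 1 + 2 * s = M by rewrite /M; lia.
have -> : n%:Z - 1 + 2 * (s + 1) = M + 1 + 1 by rewrite /M; lia.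
have -> : j.+1%:Z - 3 * s - 0 = K by rewrite /K; lia.
have -> : j.+1%:Z - 3 * s - 1 = K - 1 by rewrite /K; lia.
have -> : j%:Z - 3 * s - 0 = K - 1 by rewrite /K; lia.
have -> : j%:Z - 3 * s - 1 = K - 1 - 1 by rewrite /K; lia.
have -> : j%:Z + 1 - 3 * (s + 1) = K - 1 - 1 - 1 by rewrite /K; lia.
have -> : j.+1%:Z + 3 * s + 0 = L - 1 by rewrite /L; lia.
have -> : j.+1%:Z + 3 * s + 1 = L by rewrite /L; lia.
have -> : j%:Z + 3 * s + 0 = L - 1 - 1 by rewrite /L; lia.
have -> : j%:Z + 3 * s + 1 = L - 1 by rewrite /L; lia.
have -> : j%:Z - 1 + 3 * s = L - 1 - 1 - 1 by rewrite /L; lia.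
have -> : j%:Z - 1 + 3 * (s + 1) = L by rewrite /L; lia.
rewrite -/K !binz_pascal; ring.
Qed.

(* The sum over -B <= s <= B, which is the full sum over the integers once
   B >= j. *)
Definition cyl_sum (B n j : nat) : int :=
  \sum_(0 <= i < (B + B.+1)%N) cyl_diff (i%:Z - B%:Z) n j.

Lemma cyl_sum_rec B n j : (j < B)%N ->
  cyl_sum B n.+2 j.+1 = 2 * cyl_sum B n.+1 j.+1 - cyl_sum B n j.+1 + cyl_sum B n j.
Proof.
move=> jB; apply/eqP; rewrite -subr_eq0 /cyl_sum mulr_sumr; apply/eqP.
rewrite [LHS](_ : _ = \sum_(0 <= i < (B + B.+1)%N)
   (cyl_flux (i%:Z - B%:Z) n j - cyl_flux (i.+1%:Z - B%:Z) n j)); last first.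
  rewrite -sumrB -big_split -sumrB; apply: eq_bigr => i _ /=.
  have -> : i.+1%:Z - B%:Z = i%:Z - B%:Z + 1 by lia.
  by rewrite -cyl_diff_rec; ring.
under eq_bigr do rewrite -opprB.
rewrite sumrN telescope_sumr // /cyl_flux.
(* Both boundary fluxes, at s = B + 1 and s = -B, have a negative lower index. *)
rewrite (binz_neg _ (j%:Z + 1 - 3 * ((B + B.+1)%N%:Z - B%:Z))); last lia.
by rewrite (binz_neg _ (j%:Z - 1 + 3 * (0%:Z - B%:Z))) ?mul0r ?mulr0 ?subrr ?oppr0 //; lia.
Qed.

(** If the first lower index is nonnegative, then j >= 3s + a, so the second one is at least 6s - 2,
    beyond its upper index n + 2s - 1 <= 4s - 1. *)
Lemma cyl_term_small (a s : int) n j :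
  0 < s -> -1 <= a -> a <= 1 -> n%:Z <= 2 * s -> cyl_term a s n j = 0.
Proof.
move=> s0 a1 a2 ns; rewrite /cyl_term.
have [lt|ge] := ltP (j%:Z - 3 * s - a) 0; first by rewrite binz_neg ?mul0r.
by rewrite (binz_small (n%:Z + 2 * s - 1)) ?mulr0 //; lia.
Qed.

(** The terms at s and -s are paired through [cyl_termN]. *)
Lemma cyl_sumE B n j : cyl_sum B n j = cyl_diff 0 n j
  - \sum_(1 <= s < B.+1) (cyl_term 1 s n j - 2 * cyl_term 0 s n j + cyl_term (-1) s n j).
Proof.
rewrite /cyl_sum (big_cat_nat (n := B)) //=; last by rewrite leq_addr.
rewrite big_nat_rev (@big_addn _ _ _ 0 (B + B.+1) B) addKn big_nat_recl //.
rewrite big_add1 /= addrCA -sumrN -big_split; congr (_ + _).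
  by congr (cyl_diff _ n j); lia.
apply: eq_big_nat => i /andP[_ iB] /=.
have -> : (0 + B - i.+1)%N%:Z - B%:Z = - i.+1%:Z by lia.
have -> : (i.+1 + B)%N%:Z - B%:Z = i.+1%:Z by lia.
by rewrite /cyl_diff !cyl_termN oppr0; ring.
Qed.

(** The left side is C(n, j)^2 - C(n, j - 1) C(n, j + 1), the determinant form of the Narayana
    number. *)
Lemma cyl_diff0E n j :
  (cyl_diff 0 n.+1 j)%:~R = narayana n.+1 j.+1.
Proof.
have -> : cyl_diff 0 n.+1 j = 'C(n, j)%:Z * 'C(n, j)%:Z - binz n (j%:Z - 1) * 'C(n, j.+1)%:Z.
  have n1 : n.+1%:Z - 1 = n by lia.
  rewrite /cyl_diff /cyl_term !mulr0 !subr0 ?addr0 n1.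
  by have -> : j%:Z + 1 = j.+1 by lia.
rewrite /narayana (_ : j.+1%:Z - 1 = j); last lia.
have n0 : n.+1%:R != 0 :> rat by rewrite pnatr_eq0.
apply: (mulfI n0); rewrite !mulrA mulfV // mul1r.
apply/eqP; rewrite -[n.+1%:R]/(n.+1%:Z%:~R) -!intrM eqr_int; apply/eqP.
case: j => [|j].
  by rewrite /= !bin0 !bin1; lia.
have -> : binz n (j.+1%:Z - 1) = 'C(n, j) by have -> : j.+1%:Z - 1 = j by lia.
rewrite /=.
have h1 := mul_bin_left n j; have h2 := mul_bin_left n j.+1.
have [jn|nj] := ltnP j n; last first.
  by rewrite (@bin_small n j.+1) ?(@bin_small n j.+2) ?(@bin_small n.+1 j.+2)
    ?mulr0 ?mul0r ?subrr ?mulr0 //; lia.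
move: h1 h2 => /(congr1 Posz) + /(congr1 Posz).
rewrite !PoszM -!subzn //; last exact: ltnW.
rewrite !binS !PoszD.
move: ('C(n, j)%:Z) ('C(n, j.+1)%:Z) ('C(n, j.+2)%:Z) => a b c h1 h2.
apply/eqP; rewrite -subr_eq0; apply/eqP.
(* Both brackets vanish, by (m + 1) C(n, m + 1) = (n - m) C(n, m) at m = j and m = j + 1. *)
transitivity ((b + c) * (j.+1%:Z * b - (n%:Z - j%:Z) * a)
   - (a + b) * (j.+2%:Z * c - (n%:Z - j.+1%:Z) * b)); last first.
  by rewrite h1 h2 !subrr !mulr0 subrr.
by rewrite -!natz !mulrS; ring.
Qed.

Lemma cyl_sum_bin B n j : (j <= B)%N -> cyl_sum B n.+1 j = 'C(n.+1, 2 * j).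
Proof.
elim: j n => [|j IHj] n jB.
  rewrite cyl_sumE big_nat big1 /cyl_diff /cyl_term.
    by rewrite !mulr0 ?subr0 ?addr0 !binz0 mulr1 bin0.
  by move=> s /andP[s0 _]; rewrite !(binz_neg _ (0%:Z - _ - _)); lia.
(* The recurrence has order two in n, so each j needs two initial values; for these only s = 0
   contributes. *)
have ini m : (m <= 1)%N -> cyl_sum B m.+1 j.+1 = 'C(m.+1, 2 * j.+1).
  move=> m1; rewrite cyl_sumE big_nat big1 => [|s /andP[s0 _]]; last first.
    by rewrite !cyl_term_small ?mulr0 ?subr0 //; lia.
  case: m m1 => [|[|]] // _; case: j {IHj jB} => [|j]; rewrite subr0 /cyl_diff /cyl_term.
  - by [].
  - by rewrite (binz_small _ (j.+2%:Z + 3 * 0 + 0)) ?(binz_small _ (j.+2%:Z + 3 * 0 + 1))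
      ?mul0r ?mulr0 ?bin_small //; lia.
  - by [].
  - by rewrite (binz_small _ (j.+2%:Z + 3 * 0 + 0)) ?(binz_small _ (j.+2%:Z + 3 * 0 + 1))
      ?mul0r ?mulr0 ?bin_small //; lia.
suff H : cyl_sum B n.+1 j.+1 = 'C(n.+1, 2 * j.+1) /\ cyl_sum B n.+2 j.+1 = 'C(n.+2, 2 * j.+1).
  by case: H.
elim: n => [|n [IH1 IH2]]; first by split; apply: ini.
split=> //; rewrite cyl_sum_rec // IH1 IH2 IHj; last lia.
have -> : (2 * j.+1 = (2 * j).+2)%N by lia.
rewrite !(binS n.+2) !(binS n.+1) !PoszD; ring.
Qed.

Lemma Qtilde3E (a : int) n j B : -1 <= a -> (j <= B)%N ->
  Qtilde3 a n j = \sum_(1 <= s < B.+1) cyl_term a s n j.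
Proof.
move=> a1 jB; rewrite /Qtilde3 (fsbigE (index_iota 1 B.+1)).
- rewrite big_seq_cond [RHS]big_seq; apply: eq_bigl => s; rewrite mem_index_iota.
  by case: (boolP (1 <= s < B.+1)%N) => //= /andP[s1 _]; apply: mem_set.
- exact: iota_uniq.
- by move=> s /=; rewrite mem_index_iota => /andP[].
(* For s > B >= j the lower index j - 3s - a is negative. *)
by move=> s /= s1; rewrite mem_index_iota => sB; rewrite binz_neg ?mul0r //; lia.
Qed.

Lemma bin_narayana n j : 'C(n.+1, 2 * j)%:R =
       narayana n.+1 j.+1
       - (Qtilde3 1 n.+1 j - 2 * Qtilde3 0 n.+1 j + Qtilde3 (-1) n.+1 j)%:~R :> rat.
Proof.
rewrite !(@Qtilde3E _ _ _ j) // mulr_sumr -sumrB -big_split /=.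
by rewrite -cyl_diff0E -rmorphB /= -cyl_sumE cyl_sum_bin.
Qed.

Theorem theorem22 (n j : nat) (hn : (1 <= n)%N) :
  a231 1 n j = htree 3 n.+1 (n - j)%N
  /\ ('C(n, 2 * j)%N)%:R =
       narayana n j.+1
       - (Qtilde3 1 n j - 2 * Qtilde3 0 n j + Qtilde3 (-1) n j)%:~R :> rat.
Proof.
case: n hn => // n _; split; last exact: bin_narayana.
by rewrite a231_1E htree3E.
Qed.
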